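(* Let $n\ge 2$ and $m\ge1$, and consider the Hermite–Bézier Lane–Riesenfeld subdivision scheme of order $m$ (HB-LRm) in $\mathbb{R}^n$. (a) The HB-LRm scheme reconstructs lines and circles: if the initial data $\left((p_j,v_j)\right)_{j\in\mathbb{Z}}$ are geometric Hermite samples of an oriented straight line (respectively, of an oriented circle) in $\mathbb{R}^n$, then at every refinement level the refined data are again geometric Hermite samples of the same oriented line (respectively, circle); hence the limit, when it exists, lies on that line (respectively, circle). (b) For converging HB-LRm schemes the limits are invariant under isometries and scalings: suppose the HB-LRm scheme applied to initial data $P=\left((p_j,v_j)\right)_{j\in\mathbb{Z}}$ converges, with limit point curve $\gamma:\mathbb{R}\to\mathbb{R}^n$ and limit of the unit tangents $\nu:\mathbb{R}\to S^{n-1}$. Then for every isometry $\Phi:\mathbb{R}^n\to\mathbb{R}^n$ the scheme applied to $\left((\Phi(p_j),\Phi(v_j)-\Phi(0))\right)_{j\in\mathbb{Z}}$ converges with limits $\Phi\circ\gamma$ and $\Phi\circ\nu-\Phi(0)$, and for every $a>0$ the scheme applied to $\left((a p_j,v_j)\right)_{j\in\mathbb{Z}}$ converges with limits $a\gamma$ and $\nu$.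
   Context: $\mathbb{R}^n$ carries the Euclidean inner product $\langle\cdot,\cdot\rangle$ and norm $\|\cdot\|$; $S^{n-1}$ is the unit sphere with the angular metric. Bézier average with weight $\frac12$: for $(p_0,v_0),(p_1,v_1)\in\mathbb{R}^n\times S^{n-1}$ with $p_0\ne p_1$ put $u=\frac{p_1-p_0}{\|p_1-p_0\|}$, $\theta_j=\arccos\langle v_j,u\rangle\in[0,\pi]$; if $\theta_0+\theta_1<2\pi$ put $\alpha=\frac{\|p_1-p_0\|}{3\cos^2((\theta_0+\theta_1)/4)}$. Let $b$ be the cubic Bézier curve on $[0,1]$ with control points $p_0,\,p_0+\alpha v_0,\,p_1-\alpha v_1,\,p_1$, i.e. $b(t)=(1-t)^3p_0+3t(1-t)^2(p_0+\alpha v_0)+3t^2(1-t)(p_1-\alpha v_1)+t^3p_1$. Then $B_{1/2}\left((p_0,v_0),(p_1,v_1)\right)=\left(b(\tfrac12),\,b'(\tfrac12)/\|b'(\tfrac12)\|\right)$. HB-LRm refinement step: given data $Q_i=(p_i,v_i)$, $i\in\mathbb{Z}$, set $Q^1_{2i}=Q_i$ and $Q^1_{2i+1}=B_{1/2}(Q_i,Q_{i+1})$; then for $j=2,\dots,m$ set $Q^j_i=B_{1/2}(Q^{j-1}_i,Q^{j-1}_{i+1})$, $i\in\mathbb{Z}$. The refined data are $(Q^m_i)_{i\in\mathbb{Z}}$. The scheme applies this step repeatedly, producing data $\left((p^k_j,v^k_j)\right)_{j\in\mathbb{Z}}$ at level $k\ge 0$. (In (b) it is understood that all averages needed are defined at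 all levels.) Geometric Hermite samples of an oriented line with unit direction $u$: points $p_j$ on the line with $p_{j+1}-p_j$ a positive multiple of $u$ and $v_j=u$ for all $j$. Geometric Hermite samples of an oriented circle: points $p_j$ on the circle with $p_j\ne p_{j+1}$ and $v_j$ the unit tangent at $p_j$ compatible with the orientation. Convergence: the piecewise linear interpolants $f_k$ to $(2^{-k}j,p^k_j)_{j\in\mathbb{Z}}$ converge uniformly on $\mathbb{R}$ (the limit is the limit point curve), and the piecewise geodesic interpolants on $S^{n-1}$ to $(2^{-k}j,v^k_j)_{j\in\mathbb{Z}}$ (arcs of great circles traversed at constant speed between consecutive non-antipodal values; defined for all large $k$) converge uniformly (the limit is the limit of the unit tangents). *)

(* Defs.v *)
From mathcomp Require Import all_boot all_order all_algebra.
From mathcomp Require Import all_classical all_reals all_analysis.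

Set Implicit Arguments.
Unset Strict Implicit.
Unset Printing Implicit Defensive.

Import Order.TTheory GRing.Theory Num.Theory.
Import numFieldNormedType.Exports.

Local Open Scope classical_set_scope.
Local Open Scope ring_scope.

(* The library norm on 'rV[R]_n is the sup norm, so the Euclidean one is
   defined here. *)
Definition dotp (R : realType) (n : nat) (x y : 'rV[R]_n) : R :=
  \sum_(i < n) x 0 i * y 0 i.

Definition enorm (R : realType) (n : nat) (x : 'rV[R]_n) : R :=
  Num.sqrt (dotp x x).

(* [normalize 0 = 0]. *)
Definition normalize (R : realType) (n : nat) (x : 'rV[R]_n) : 'rV[R]_n :=
  (enorm x)^-1 *: x.

Definition on_sphere (R : realType) (n : nat) (x : 'rV[R]_n) : Prop :=
  enorm x = 1.

(* Used only on unit vectors, where it is the metric of the sphere. *)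
Definition angle (R : realType) (n : nat) (x y : 'rV[R]_n) : R :=
  acos (dotp x y).

Definition euclidean_isometry (R : realType) (n : nat)
    (Phi : 'rV[R]_n -> 'rV[R]_n) : Prop :=
  forall x y, enorm (Phi x - Phi y) = enorm (x - y).

(* A pair (point, vector); that the vector is a unit vector is a separate
   hypothesis. *)
Definition hermite (R : realType) (n : nat) : Type :=
  ('rV[R]_n * 'rV[R]_n)%type.

Definition hermite_data (R : realType) (n : nat) (Q : int -> hermite R n) :
  Prop := forall j, on_sphere (Q j).2.

Definition bezier3 (R : realType) (n : nat) (c0 c1 c2 c3 : 'rV[R]_n) (t : R) :
    'rV[R]_n :=
  (1 - t) ^+ 3 *: c0 + (3 * t * (1 - t) ^+ 2) *: c1
    + (3 * t ^+ 2 * (1 - t)) *: c2 + t ^+ 3 *: c3.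

Definition chord_dir (R : realType) (n : nat) (Q0 Q1 : hermite R n) :
  'rV[R]_n := normalize (Q1.1 - Q0.1).

Definition angle_sum (R : realType) (n : nat) (Q0 Q1 : hermite R n) : R :=
  angle Q0.2 (chord_dir Q0 Q1) + angle Q1.2 (chord_dir Q0 Q1).

(* The domain of the average.  For unit vectors the derivative normalized in
   [bezier_avg] does not vanish on it. *)
Definition bezier_avg_defined (R : realType) (n : nat) (Q0 Q1 : hermite R n) :
  Prop := Q0.1 <> Q1.1 /\ angle_sum Q0 Q1 < 2 * pi.

Definition bezier_alpha (R : realType) (n : nat) (Q0 Q1 : hermite R n) : R :=
  enorm (Q1.1 - Q0.1) / (3 * cos (angle_sum Q0 Q1 / 4) ^+ 2).

Definition bezier_curve (R : realType) (n : nat) (Q0 Q1 : hermite R n) :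
    R -> 'rV[R]_n :=
  bezier3 Q0.1 (Q0.1 + bezier_alpha Q0 Q1 *: Q0.2)
          (Q1.1 - bezier_alpha Q0 Q1 *: Q1.2) Q1.1.

(* Total function, meaningful under [bezier_avg_defined]. *)
Definition bezier_avg (R : realType) (n : nat) (Q0 Q1 : hermite R n) :
    hermite R n :=
  (bezier_curve Q0 Q1 2^-1, normalize (derive1 (bezier_curve Q0 Q1) 2^-1)).

(* [divz] and [modz] are floor division and nonnegative remainder, so an odd
   index [2 i + 1] has [(j %/ 2)%Z = i] for negative [i] too. *)
Definition refine0 (R : realType) (n : nat) (Q : int -> hermite R n) :
    int -> hermite R n :=
  fun j => if (j %% 2)%Z == 0 then Q (j %/ 2)%Z
           else bezier_avg (Q (j %/ 2)%Z) (Q ((j %/ 2)%Z + 1)).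

Definition smooth (R : realType) (n : nat) (Q : int -> hermite R n) :
    int -> hermite R n :=
  fun i => bezier_avg (Q i) (Q (i + 1)).

Definition hblr_step (R : realType) (n m : nat) (Q : int -> hermite R n) :
  int -> hermite R n := iter m.-1 (@smooth R n) (refine0 Q).

Definition averages_defined (R : realType) (n : nat) (Q : int -> hermite R n) :
  Prop := forall i, bezier_avg_defined (Q i) (Q (i + 1)).

Definition hblr_step_defined (R : realType) (n m : nat)
    (Q : int -> hermite R n) : Prop :=
  averages_defined Q /\
  forall l, (l < m.-1)%N -> averages_defined (iter l (@smooth R n) (refine0 Q)).

Definition hblr_level (R : realType) (n m : nat) (P : int -> hermite R n)
    (k : nat) : int -> hermite R n :=
  iter k (@hblr_step R n m) P.

Definition hblr_defined (R : realType) (n m : nat) (P : int -> hermite R n) :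
  Prop := forall k, hblr_step_defined m (hblr_level m P k).

Definition line_point (R : realType) (n : nat) (a u p : 'rV[R]_n) : Prop :=
  exists t : R, p = a + t *: u.

Definition line_samples (R : realType) (n : nat) (a u : 'rV[R]_n)
    (Q : int -> hermite R n) : Prop :=
  [/\ forall j, line_point a u (Q j).1,
      forall j, exists2 c : R, 0 < c & (Q (j + 1)).1 - (Q j).1 = c *: u
    & forall j, (Q j).2 = u].

(* The oriented circle with center [c] and radius [r] in the plane directed by
   the orthonormal pair [(e1, e2)], run from [e1] towards [e2]. *)
Definition oriented_circle (R : realType) (n : nat) (r : R)
    (e1 e2 : 'rV[R]_n) : Prop :=
  [/\ 0 < r, on_sphere e1, on_sphere e2 & dotp e1 e2 = 0].

Definition circle_pt (R : realType) (n : nat) (c : 'rV[R]_n) (r : R)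
    (e1 e2 : 'rV[R]_n) (phi : R) : 'rV[R]_n :=
  c + r *: (cos phi *: e1 + sin phi *: e2).

Definition circle_tangent (R : realType) (n : nat) (e1 e2 : 'rV[R]_n)
    (phi : R) : 'rV[R]_n :=
  - sin phi *: e1 + cos phi *: e2.

Definition circle_samples (R : realType) (n : nat) (c : 'rV[R]_n) (r : R)
    (e1 e2 : 'rV[R]_n) (Q : int -> hermite R n) : Prop :=
  (forall j, exists phi : R,
     (Q j).1 = circle_pt c r e1 e2 phi /\ (Q j).2 = circle_tangent e1 e2 phi)
  /\ (forall j, (Q j).1 <> (Q (j + 1)).1).

Definition linear_arc (R : realType) (n : nat) (p q : 'rV[R]_n) (s : R) :
  'rV[R]_n := (1 - s) *: p + s *: q.

(* The great circle arc from [v] to [w], at constant speed [angle v w] for [s]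
   in [0, 1]; constant if [v = w], not meaningful if [w = - v]. *)
Definition geodesic_arc (R : realType) (n : nat) (v w : 'rV[R]_n) (s : R) :
    'rV[R]_n :=
  cos (s * angle v w) *: v
    + sin (s * angle v w) *: normalize (w - dotp v w *: v).

(* The interpolant of the values [x j] at the parameters [2^-k j]. *)
Definition interpolant (R : realType) (n : nat)
    (arc : 'rV[R]_n -> 'rV[R]_n -> R -> 'rV[R]_n)
    (k : nat) (x : int -> 'rV[R]_n) (t : R) : 'rV[R]_n :=
  let j := Num.floor (2 ^+ k * t) in
  arc (x j) (x (j + 1)) (2 ^+ k * t - j%:~R).

Definition point_interpolant (R : realType) (n m : nat)
    (P : int -> hermite R n) (k : nat) : R -> 'rV[R]_n :=
  interpolant (@linear_arc R n) k (fun j => (hblr_level m P k j).1).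

Definition tangent_interpolant (R : realType) (n m : nat)
    (P : int -> hermite R n) (k : nat) : R -> 'rV[R]_n :=
  interpolant (@geodesic_arc R n) k (fun j => (hblr_level m P k j).2).

Definition limit_point_curve (R : realType) (n m : nat)
    (P : int -> hermite R n) (gamma : R -> 'rV[R]_n) : Prop :=
  forall e : R, 0 < e -> \forall k \near \oo,
    forall t : R, enorm (point_interpolant m P k t - gamma t) < e.

Definition limit_unit_tangents (R : realType) (n m : nat)
    (P : int -> hermite R n) (nu : R -> 'rV[R]_n) : Prop :=
  [/\ forall t : R, on_sphere (nu t),
      \forall k \near \oo, forall j : int,
        (hblr_level m P k (j + 1)).2 <> - (hblr_level m P k j).2
    & forall e : R, 0 < e -> \forall k \near \oo,
        forall t : R, angle (tangent_interpolant m P k t) (nu t) < e].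

Definition hblr_converges (R : realType) (n m : nat) (P : int -> hermite R n)
    (gamma nu : R -> 'rV[R]_n) : Prop :=
  [/\ hblr_defined m P, limit_point_curve m P gamma
    & limit_unit_tangents m P nu].

(* Main.v *)
Require Import Defs.
From HB Require Import structures.
From mathcomp Require Import all_boot all_order all_algebra.
From mathcomp Require Import all_classical all_reals all_analysis.
From mathcomp Require Import zify ring lra.

Import Order.TTheory GRing.Theory Num.Theory.
Import numFieldNormedType.Exports.

Local Open Scope ring_scope.

(** Every statement reduces to a property of one Bezier average.

    Reconstruction of lines and circles.  Call a pair of data a step if it
    consists of an initial and a later sample of the same line or circle (on the
    circle: later by less than a full turn).  The average of a step is the
    sample halfway: the midpoint of the segment ([line_step_avg]), or the middle
    of the arc ([circle_avg]), which is the reason for the factor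
    [1 / (3 cos ^ 2)] in the length of the tangent legs.  Taking halfway samples
    turns steps into steps, so a sequence of consecutive steps remains one under
    insertion and smoothing, and all averages are defined ([hblr_chain]).

    Limits on lines and circles.  The interpolants leave the circle, but every
    value of the limit curve is adherent to the set of all data of all levels
    ([limit_point_curve_adherent]), and lines and circles are closed
    ([line_point_closed], [circle_pt_closed]).

    Invariance.  An isometry is affine with an orthogonal linear part
    ([euclidean_isometry_linear]), so isometries and scalings are both instances
    of a similarity [p |-> a L p + d] acting on unit vectors by [L].  The average
    commutes with it ([bezier_avg_sim]), hence so do all levels and both kinds of
    interpolants; distances are multiplied by [a] and angles are unchanged, so
    the convergence is transported too ([hblr_converges_sim]). *)

(** * Euclidean geometry *)

Section Euclidean.
Context {R : realType} {n : nat}.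
Implicit Types (x y z u : 'rV[R]_n) (a : R).

Lemma dotpC x y : dotp x y = dotp y x.
Proof. by apply: eq_bigr => i _; rewrite mulrC. Qed.

Lemma dotpDl x y z : dotp (x + y) z = dotp x z + dotp y z.
Proof. by rewrite -big_split; apply: eq_bigr => i _; rewrite mxE mulrDl. Qed.

Lemma dotpZl a x y : dotp (a *: x) y = a * dotp x y.
Proof. by rewrite mulr_sumr; apply: eq_bigr => i _; rewrite mxE mulrA. Qed.

Lemma dotpNl x y : dotp (- x) y = - dotp x y.
Proof. by rewrite -scaleN1r dotpZl mulN1r. Qed.

Lemma dotpDr x y z : dotp x (y + z) = dotp x y + dotp x z.
Proof. by rewrite !(dotpC x) dotpDl. Qed.

Lemma dotpZr a x y : dotp x (a *: y) = a * dotp x y.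
Proof. by rewrite !(dotpC x) dotpZl. Qed.

Lemma dotpNr x y : dotp x (- y) = - dotp x y.
Proof. by rewrite !(dotpC x) dotpNl. Qed.

Definition dotpE := (dotpDl, dotpDr, dotpZl, dotpZr, dotpNl, dotpNr).

Lemma dotp_ge0 x : 0 <= dotp x x.
Proof. by apply: sumr_ge0 => i _; rewrite -expr2 sqr_ge0. Qed.

Lemma dotp_eq0 x : dotp x x = 0 -> x = 0.
Proof.
move/eqP; rewrite psumr_eq0; last by move=> i _; rewrite -expr2 sqr_ge0.
move/allP => h; apply/rowP => i; rewrite mxE; apply/eqP.
by have := h i (mem_index_enum i); rewrite mulf_eq0 orbb.
Qed.

Lemma enorm_ge0 x : 0 <= enorm x.
Proof. exact: sqrtr_ge0. Qed.

Lemma sqr_enorm x : enorm x ^+ 2 = dotp x x.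
Proof. by rewrite sqr_sqrtr ?dotp_ge0. Qed.

Lemma on_sphere_dotp x : on_sphere x -> dotp x x = 1.
Proof. by rewrite /on_sphere -sqr_enorm => ->; rewrite expr1n. Qed.

Lemma dotp_on_sphere x : dotp x x = 1 -> on_sphere x.
Proof. by rewrite /on_sphere /enorm => ->; rewrite sqrtr1. Qed.

Lemma enorm_eq0 x : enorm x = 0 -> x = 0.
Proof. by move=> h; apply: dotp_eq0; rewrite -sqr_enorm h expr0n. Qed.

Lemma enorm_gt0 x : x <> 0 -> 0 < enorm x.
Proof.
by move=> h; rewrite lt_neqAle enorm_ge0 andbT eq_sym; apply/eqP=> /enorm_eq0.
Qed.

Lemma enormZ a x : enorm (a *: x) = `|a| * enorm x.
Proof. by rewrite /enorm !dotpE mulrA -expr2 sqrtrM ?sqr_ge0 // sqrtr_sqr. Qed.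

Lemma enormN x : enorm (- x) = enorm x.
Proof. by rewrite -scaleN1r enormZ normrN1 mul1r. Qed.

Lemma normalizeZ a x : 0 < a -> normalize (a *: x) = normalize x.
Proof.
move=> a0; rewrite /normalize enormZ gtr0_norm // scalerA invfM.
by rewrite mulrAC mulVf ?mul1r // gt_eqF.
Qed.

Lemma normalize_on_sphere x : on_sphere x -> normalize x = x.
Proof. by rewrite /normalize => ->; rewrite invr1 scale1r. Qed.

Lemma enorm_small_eq0 x : (forall e, 0 < e -> enorm x < e) -> x = 0.
Proof.
move=> h; have [->//|x0] := pselect (x = 0).
by have := h _ (enorm_gt0 _ x0); rewrite ltxx.
Qed.

(** The squared norm of [(y.y) x - (x.y) y] is nonnegative, and equal to
    [y.y] times the defect of the squared inequality. *)
Lemma cauchy_schwarz x y : dotp x y <= enorm x * enorm y.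
Proof.
have [->|y0] := pselect (y = 0).
  have d0 : dotp x 0 = 0 by rewrite -(scale0r (0 : 'rV_n)) dotpZr mul0r.
  by rewrite d0 mulr_ge0 ?enorm_ge0.
have yy : 0 < dotp y y by rewrite -sqr_enorm exprn_gt0 // enorm_gt0.
have := dotp_ge0 (dotp y y *: x - dotp x y *: y).
rewrite !dotpE (dotpC y x) => h.
have h2 : dotp x y ^+ 2 <= dotp x x * dotp y y by nra.
apply: le_trans (ler_norm _) _.
rewrite -(@ler_pXn2r _ 2) ?nnegrE ?normr_ge0 ?mulr_ge0 ?enorm_ge0 //.
by rewrite real_normK ?num_real // exprMn !sqr_enorm.
Qed.

Lemma enorm_triangle x y : enorm (x + y) <= enorm x + enorm y.
Proof.
rewrite -(@ler_pXn2r _ 2) ?nnegrE ?addr_ge0 ?enorm_ge0 //.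
rewrite sqrrD !sqr_enorm !dotpE (dotpC y x).
by have := cauchy_schwarz x y; lra.
Qed.

End Euclidean.

(** * Cubic Bezier curves at the midpoint *)

Section Bezier.
Context {R : realType} {n : nat}.
Implicit Types (v : 'rV[R]_n).

Lemma is_derive_scalev (g : R -> R) (dg t : R) v :
  is_derive t 1 g dg -> is_derive t 1 (fun s => g s *: v) (dg *: v).
Proof.
move=> [dv ev].
have h : ((h^-1 *: (g (h *: 1 + t) - g t)) *: v @[h --> 0^'] --> dg *: v)%classic.
  apply: cvgZr_tmp; rewrite -ev; exact: dv.
have h' :
    (h^-1 *: (g (h *: 1 + t) *: v - g t *: v) @[h --> 0^'] --> dg *: v)%classic.
  apply: cvg_trans h; apply: near_eq_cvg; near=> h => /=.
  by rewrite -scalerBl scalerA.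
apply: DeriveDef; first by apply/cvg_ex; exists (dg *: v).
by apply: cvg_lim h'.
Unshelve. all: by end_near.
Qed.

Lemma derive1_bezier3_half (c0 c1 c2 c3 : 'rV[R]_n) :
  derive1 (bezier3 c0 c1 c2 c3) 2^-1 = (3 / 4) *: (c3 + c2 - c1 - c0).
Proof.
(* The Bernstein weights are differentiated formally, as polynomials. *)
have d (p : {poly R}) (g : R -> R) (dg : R) : (forall t, g t = p.[t]) ->
    p^`().[2^-1] = dg -> is_derive (2^-1 : R) (1 : R) g dg.
  move=> /funext -> <-; exact: is_derive_poly.
have d0 : is_derive (2^-1 : R) (1 : R) (fun t => (1 - t) ^+ 3) (- (3 / 4)).
  apply: (d ((1 - 'X) ^+ 3)) => [t|]; first by rewrite !hornerE.
  by rewrite !poly.derivE !hornerE /=; field.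
have d1 : is_derive (2^-1 : R) (1 : R)
    (fun t => 3 * t * (1 - t) ^+ 2) (- (3 / 4)).
  apply: (d (3%:P * 'X * (1 - 'X) ^+ 2)) => [t|]; first by rewrite !hornerE.
  by rewrite !poly.derivE !hornerE /=; field.
have d2 : is_derive (2^-1 : R) (1 : R) (fun t => 3 * t ^+ 2 * (1 - t)) (3 / 4).
  apply: (d (3%:P * 'X ^+ 2 * (1 - 'X))) => [t|]; first by rewrite !hornerE.
  by rewrite !poly.derivE !hornerE /=; field.
have d3 : is_derive (2^-1 : R) (1 : R) (fun t => t ^+ 3) (3 / 4).
  apply: (d ('X ^+ 3)) => [t|]; first by rewrite !hornerE.
  by rewrite !poly.derivE !hornerE /=; field.
rewrite derive1E.
have := is_deriveD (is_deriveD (is_deriveD (is_derive_scalev _ _ _ c0 d0)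
  (is_derive_scalev _ _ _ c1 d1)) (is_derive_scalev _ _ _ c2 d2))
  (is_derive_scalev _ _ _ c3 d3).
move=> /(@derive_val _ _ _ _ _ _ _) ->.
by apply/rowP => i; rewrite !mxE; ring.
Qed.

Lemma bezier3_half (c0 c1 c2 c3 : 'rV[R]_n) :
  bezier3 c0 c1 c2 c3 2^-1 = 8^-1 *: (c0 + 3 *: c1 + 3 *: c2 + c3).
Proof. by apply/rowP => i; rewrite !mxE; field. Qed.

End Bezier.

(** * Invariants of the refinement and adherence of the limit *)

Section Scheme.
Context {R : realType} {n : nat}.
Implicit Types (Q : int -> hermite R n).

Lemma int_parity (j : int) : exists i : int, j = i * 2 \/ j = i * 2 + 1.
Proof.
exists (j %/ 2)%Z.
by have := divz_eq j 2; have := modz_ge0 j (isT : 2 != 0 :> int);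
  have := ltz_pmod j (isT : 0 < 2 :> int); lia.
Qed.

Lemma refine0_even Q (i : int) : refine0 Q (i * 2) = Q i.
Proof. by rewrite /refine0 modzMl mulzK. Qed.

Lemma refine0_odd Q (i : int) :
  refine0 Q (i * 2 + 1) = bezier_avg (Q i) (Q (i + 1)).
Proof.
rewrite /refine0.
have -> : ((i * 2 + 1) %% 2)%Z = 1 by rewrite modzMDl.
have -> : ((i * 2 + 1) %/ 2)%Z = i by rewrite divzMDl // addr0.
by [].
Qed.

Definition chain (N : hermite R n -> hermite R n -> Prop) Q : Prop :=
  forall i : int, N (Q i) (Q (i + 1)).

(** Every index-independent property of consecutive data that survives the
    three ways in which a refinement step creates consecutive pairs holds at
    all levels: the initial insertion pairs an old datum with the average on
    either side of it, and a smoothing pairs two adjacent averages. *)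
Lemma hblr_chain (N : hermite R n -> hermite R n -> Prop) (m : nat) :
  (forall x y, N x y -> bezier_avg_defined x y) ->
  (forall x y, N x y -> N x (bezier_avg x y) /\ N (bezier_avg x y) y) ->
  (forall x y z, N x y -> N y z -> N (bezier_avg x y) (bezier_avg y z)) ->
  forall P, chain N P ->
  hblr_defined m P /\ forall k, chain N (hblr_level m P k).
Proof.
move=> Ndef Nhalf Nsm P NP.
have Nref Q : chain N Q -> chain N (refine0 Q).
  move=> NQ j; have [i [->|->]] := int_parity j.
    by rewrite refine0_even refine0_odd; case: (Nhalf _ _ (NQ i)).
  have -> : i * 2 + 1 + 1 = (i + 1) * 2 :> int by ring.
  by rewrite refine0_even refine0_odd; case: (Nhalf _ _ (NQ i)).
have Niter Q l : chain N Q -> chain N (iter l (@smooth R n) (refine0 Q)).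
  by move=> /Nref NQ; elim: l => //= l IH i; exact: Nsm.
have Nlev k : chain N (hblr_level m P k).
  by elim: k => //= k IH; exact: Niter.
split=> // k; split=> [i|l _ i]; apply: Ndef; first exact: Nlev.
exact: Niter.
Qed.

Lemma expr2_unbounded (M : R) : exists l : nat, M < 2 ^+ l.
Proof.
by exists (Num.bound M); apply: upper_nthrootP. Qed.

(** The interpolants run along chords, so it is the data themselves, and not
    the values of the interpolants at [t], that must be shown to approach
    [gamma t].  Fix a level [K] whose interpolant is uniformly close to [gamma];
    it is affine on an interval to the right of [t], hence right continuous
    there.  At a fine level [K + l], the first grid parameter [t'] after [t] is
    so close to [t] that the interpolant of level [K] barely moves between the
    two, while the interpolant of level [K + l] takes a datum as its value at
    [t']. *)
Lemma limit_point_curve_adherent (m : nat) (P : int -> hermite R n)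
    (gamma : R -> 'rV[R]_n) : limit_point_curve m P gamma ->
  forall (t e : R), 0 < e ->
  exists k j, enorm ((hblr_level m P k j).1 - gamma t) < e.
Proof.
move=> lim t e e0.
have e4 : 0 < e / 4 by lra.
have [K _ hK] := lim _ e4.
set x := fun j => (hblr_level m P K j).1.
pose j0 := Num.floor (2 ^+ K * t).
pose s := 2 ^+ K * t - j0%:~R.
pose v := x (j0 + 1) - x j0.
have /andP[s0 s1] : 0 <= s < 1.
  rewrite /s subr_ge0 floor_le /= ltrBlDl.
  by have := floorD1_gt (2 ^+ K * t); rewrite intrD.
(* With this bound, a shift by [2 ^- l] in the parameter of the affine piece
   moves its value by less than [e / 4] and stays below the distance [1 - s] to
   the right end of the piece. *)
have [l hl] := expr2_unbounded (enorm v / (e / 4) + 1 / (1 - s)).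
have v0 : 0 <= enorm v / (e / 4) by rewrite divr_ge0 ?enorm_ge0 ?ltW.
have s'0 : 0 < 1 / (1 - s) by rewrite divr_gt0 ?subr_gt0.
have pl : 0 < (2 : R) ^+ l by rewrite exprn_gt0.
have pK : 0 < (2 : R) ^+ K by rewrite exprn_gt0.
have lv : (2 ^+ l)^-1 * enorm v < e / 4.
  by rewrite mulrC ltr_pdivrMr // mulrC -ltr_pdivrMr //; lra.
have ls : (2 ^+ l)^-1 < 1 - s.
  rewrite -[ltLHS]div1r ltr_pdivrMr // mulrC -ltr_pdivrMr ?subr_gt0 //; lra.
pose J := Num.floor (2 ^+ (K + l) * t) + 1.
pose t' : R := J%:~R / 2 ^+ (K + l).
have et' : 2 ^+ (K + l) * t' = J%:~R.
  by rewrite /t' mulrC divfK // expf_neq0.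
pose h := 2 ^+ K * (t' - t).
have hE : 2 ^+ l * h = J%:~R - 2 ^+ (K + l) * t.
  by rewrite -et' /h exprD; ring.
have J1 : 2 ^+ (K + l) * t < J%:~R by exact: floorD1_gt.
have J2 : J%:~R <= 2 ^+ (K + l) * t + 1.
  by rewrite /J intrD lerD2r floor_le.
have h0 : 0 < h by rewrite -(pmulr_rgt0 _ pl) hE subr_gt0.
have hl' : h <= (2 ^+ l)^-1.
  by rewrite -[leRHS]div1r ler_pdivlMr // mulrC hE; lra.
have fl : Num.floor (2 ^+ K * t') = j0.
  apply: floor_def; rewrite intrD.
  have -> : 2 ^+ K * t' = j0%:~R + s + h by rewrite /h /s; ring.
  by apply/andP; split; lra.
have fKt : point_interpolant m P K t' - point_interpolant m P K t = h *: v.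
  rewrite /point_interpolant /interpolant fl -/j0 /linear_arc -!/(x _).
  rewrite /v /h.
  by apply/rowP => i; rewrite !mxE; ring.
exists (K + l)%N, J.
have -> : (hblr_level m P (K + l) J).1 = point_interpolant m P (K + l) t'.
  rewrite /point_interpolant /interpolant et' intrKfloor subrr /linear_arc.
  by rewrite subr0 scale1r scale0r addr0.
have A1 := hK (K + l)%N (leq_addr _ _) t'.
have A2 := hK K (leqnn _) t'.
have A3 := hK K (leqnn _) t.
rewrite -enormN opprB in A2.
have A4 : enorm (h *: v) < e / 4.
  apply: le_lt_trans lv; rewrite enormZ gtr0_norm //.
  by rewrite ler_wpM2r // enorm_ge0.
rewrite -fKt in A4.
set a := point_interpolant m P (K + l) t' in A1 *.
set b := point_interpolant m P K t' in A2 A4 *.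
set c := point_interpolant m P K t in A3 A4 *.
have -> : a - gamma t = (a - gamma t') + (gamma t' - b) + (b - c) + (c - gamma t).
  by apply/rowP => i; rewrite !mxE; ring.
have T1 := enorm_triangle (a - gamma t' + (gamma t' - b) + (b - c)) (c - gamma t).
have T2 := enorm_triangle (a - gamma t' + (gamma t' - b)) (b - c).
have T3 := enorm_triangle (a - gamma t') (gamma t' - b).
lra.
Qed.

End Scheme.

(** * Lines *)

Section Line.
Context {R : realType} {n : nat}.
Implicit Types (Q : int -> hermite R n) (x y z : hermite R n).

Lemma angle_id (u : 'rV[R]_n) : on_sphere u -> angle u u = 0.
Proof. by rewrite /angle => /on_sphere_dotp ->; rewrite acos1. Qed.

Definition line_step (a u : 'rV[R]_n) x y : Prop :=
  [/\ line_point a u x.1, line_point a u y.1,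
      exists2 c, 0 < c & y.1 - x.1 = c *: u, x.2 = u & y.2 = u].

(** Both angles vanish, so the control points divide the segment into three
    equal parts and the cubic is the affine parametrization of the segment. *)
Lemma line_step_avg (a u : 'rV[R]_n) x y : on_sphere u -> line_step a u x y ->
  bezier_avg_defined x y /\ bezier_avg x y = (2^-1 *: (x.1 + y.1), u).
Proof.
move=> u1 [_ _ [c c0 hc] hx hy].
have dir : chord_dir x y = u.
  by rewrite /chord_dir hc normalizeZ // normalize_on_sphere.
have ang : angle_sum x y = 0 by rewrite /angle_sum dir hx hy angle_id // addr0.
have al : bezier_alpha x y = c / 3.
  rewrite /bezier_alpha ang hc enormZ u1 mul0r cos0 gtr0_norm //.
  by rewrite expr1n !mulr1.
have hy1 : y.1 = x.1 + c *: u by rewrite -hc addrC subrK.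
split.
  split; last by rewrite ang mulr_gt0 ?pi_gt0.
  move=> e; move: hc; rewrite e subrr => /esym /(congr1 (@enorm R n)).
  rewrite enormZ u1 mulr1 gtr0_norm // => c'; move: c0; rewrite c'.
  by rewrite /enorm -(scale0r u) dotpZl mul0r sqrtr0 ltxx.
rewrite /bezier_avg /bezier_curve bezier3_half derive1_bezier3_half al hx hy hy1.
congr pair.
  by apply/rowP => i; rewrite !mxE; field.
set w := (X in normalize X).
have -> : w = c *: u by apply/rowP => i; rewrite !mxE; field.
by rewrite normalizeZ // normalize_on_sphere.
Qed.

Lemma line_point_mid (a u p q : 'rV[R]_n) : line_point a u p ->
  line_point a u q -> line_point a u (2^-1 *: (p + q)).
Proof.
move=> [s ->] [t ->]; exists (2^-1 * (s + t)).
by apply/rowP => i; rewrite !mxE; field.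
Qed.

Lemma line_samples_chain (a u : 'rV[R]_n) Q :
  line_samples a u Q <-> chain (line_step a u) Q.
Proof.
split=> [[h1 h2 h3] i|h]; first by split.
by split=> j; case: (h j).
Qed.

Lemma line_hblr (a u : 'rV[R]_n) (m : nat) P : on_sphere u ->
  line_samples a u P ->
  hblr_defined m P /\ forall k, line_samples a u (hblr_level m P k).
Proof.
move=> u1 /line_samples_chain LP.
have [] := hblr_chain (line_step a u) m _ _ _ P LP.
- by move=> x y /(line_step_avg _ _ _ _ u1)[].
- move=> x y xy; have [_ ->] := line_step_avg _ _ _ _ u1 xy.
  case: xy => lx ly [c c0 hc] hx hy.
  have lm := line_point_mid _ _ _ _ lx ly.
  split; split=> //=; exists (c / 2); rewrite ?divr_gt0 //;
    by rewrite mulrC -scalerA -hc; apply/rowP => i; rewrite !mxE; field.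
- move=> x y z xy yz.
  have [_ ->] := line_step_avg _ _ _ _ u1 xy.
  have [_ ->] := line_step_avg _ _ _ _ u1 yz.
  case: xy yz => lx ly [c c0 hc] hx hy [_ lz [d d0 hd] _ hz].
  split=> //=; try exact: line_point_mid.
  exists ((c + d) / 2); first by rewrite divr_gt0 ?addr_gt0.
  rewrite mulrC -scalerA scalerDl -hc -hd.
  by apply/rowP => i; rewrite !mxE; field.
by move=> ? h; split=> // k; apply/line_samples_chain.
Qed.

(** The component orthogonal to [u] is 1-Lipschitz and constant on the line. *)
Lemma line_point_closed (a u p : 'rV[R]_n) : on_sphere u ->
  (forall e, 0 < e -> exists2 q, line_point a u q & enorm (q - p) < e) ->
  line_point a u p.
Proof.
move=> /on_sphere_dotp u1 h.
pose w (q : 'rV[R]_n) := q - dotp q u *: u.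
have ww q : enorm (w q) <= enorm q.
  rewrite -(@ler_pXn2r _ 2) ?nnegrE ?enorm_ge0 // !sqr_enorm /w !dotpE u1.
  rewrite (dotpC u q); have := sqr_ge0 (dotp q u); lra.
suff : w (p - a) = 0.
  move=> /eqP; rewrite subr_eq0 => /eqP e; exists (dotp (p - a) u).
  by rewrite -e addrC subrK.
apply: enorm_small_eq0 => e /h[q [t ->] qp].
apply: le_lt_trans qp.
suff -> : w (p - a) = - w (a + t *: u - p) by rewrite enormN.
rewrite /w !dotpE u1.
by apply/rowP => i; rewrite !mxE; ring.
Qed.

End Line.

(** * Circles *)

Section Circle.
Context {R : realType} {n : nat}.
Implicit Types (Q : int -> hermite R n) (x y z : hermite R n).

(** The choice of [d] in one period serves twice: as the arc length between two
    samples, and as the polar angle of a limit point. *)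
Lemma unit_circle_angle (a b : R) : a ^+ 2 + b ^+ 2 = 1 ->
  exists d : R, [/\ 0 <= d, d < 2 * pi, cos d = a & sin d = b].
Proof.
move=> ab.
have a1 : -1 <= a <= 1 by apply/andP; split; nra.
have pi0 := pi_gt0 R.
have sa : sin (acos a) = `|b|.
  by rewrite sin_acos // -sqrtr_sqr; congr Num.sqrt; lra.
have ca : cos (acos a) = a by rewrite acosK // in_itv.
have [b0|b0] := leP 0 b.
  exists (acos a); split=> //; first exact: acos_ge0.
    by have := acos_lepi a1; lra.
  by rewrite sa ger0_norm.
have a1' : -1 <= a < 1.
  by case/andP: a1 => -> _ /=; nra.
exists (2 * pi - acos a); split.
- by have := acos_lepi a1; lra.
- by have := acos_gt0 a1'; lra.
- by rewrite mulr_natl cosB cos2pi sin2pi ca; ring.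
- by rewrite mulr_natl sinB cos2pi sin2pi sa ltr0_norm //; ring.
Qed.

Context (c : 'rV[R]_n) (r : R) (e1 e2 : 'rV[R]_n).
Context (oc : oriented_circle r e1 e2).

Let r0 : 0 < r. Proof. by case: oc. Qed.
Let e11 : dotp e1 e1 = 1. Proof. by case: oc => _ /on_sphere_dotp. Qed.
Let e22 : dotp e2 e2 = 1. Proof. by case: oc => _ _ /on_sphere_dotp. Qed.
Let e12 : dotp e1 e2 = 0. Proof. by case: oc. Qed.
Let e21 : dotp e2 e1 = 0. Proof. by rewrite dotpC. Qed.

Notation tangent := (circle_tangent e1 e2).
Definition circle_node (phi : R) : hermite R n :=
  (circle_pt c r e1 e2 phi, tangent phi).

Lemma dotp_tangent (s t : R) : dotp (tangent s) (tangent t) = cos (s - t).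
Proof. by rewrite /circle_tangent !dotpE e11 e22 e12 e21 cosB; ring. Qed.

Lemma tangent_sphere (t : R) : on_sphere (tangent t).
Proof. by apply: dotp_on_sphere; rewrite dotp_tangent subrr cos0. Qed.

Lemma tangent_inj (s t : R) : tangent s = tangent t ->
  cos s = cos t /\ sin s = sin t.
Proof.
move=> e; split.
  by have := congr1 (fun v => dotp v e2) e; rewrite /= !dotpE e22 e12; lra.
by have := congr1 (fun v => dotp v e1) e; rewrite /= !dotpE e11 e21; lra.
Qed.

Lemma circle_node_eq (s t : R) : cos s = cos t -> sin s = sin t ->
  circle_node s = circle_node t.
Proof. by rewrite /circle_node /circle_pt /circle_tangent => -> ->. Qed.

(** Equal nodes have parameters that differ by a period; this is what lets two
    consecutive arcs be measured along a common parametrization. *)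
Lemma circle_node_shift (s t d : R) : circle_node s = circle_node t ->
  circle_node (s + d) = circle_node (t + d).
Proof.
by case=> _ /tangent_inj[cs ss]; apply: circle_node_eq; rewrite ?cosD ?sinD cs ss.
Qed.

(** The chord of an arc is parallel to the tangent at the middle of the arc. *)
Lemma circle_chord (mu h : R) :
  circle_pt c r e1 e2 (mu + h) - circle_pt c r e1 e2 (mu - h) =
  (2 * r * sin h) *: tangent mu.
Proof.
rewrite /circle_pt /circle_tangent cosB sinB cosD sinD.
by apply/rowP => i; rewrite !mxE; ring.
Qed.

(** The arc from [x] to [y] is described by its middle and its half length [h],
    as its average is the node in the middle.  The bound [h < pi] lets the arc
    be as long as a full turn, excluded. *)
Definition circle_step x y : Prop :=
  exists mu h, [/\ 0 < h, h < pi, x = circle_node (mu - h) &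
    y = circle_node (mu + h)].

Lemma circle_step_neq x y : circle_step x y -> x.1 <> y.1.
Proof.
move=> [mu [h [h0 hpi -> ->]]] /= /eqP; rewrite eq_sym -subr_eq0 circle_chord.
move=> /eqP/(congr1 (fun v => dotp v (tangent mu))) /=.
rewrite dotpZl (on_sphere_dotp _ (tangent_sphere _)) -(scale0r e1) dotpZl mul0r.
have sh : 0 < sin h by rewrite sin_gt0_pi // h0.
by apply/eqP; rewrite mulr1 !mulf_neq0 // gt_eqF.
Qed.

(** The chord makes the angle [h] with both end tangents, whence
    [alpha = 4 r tan (h / 2) / 3].  The Bezier midpoint lies on the radius
    through the middle of the arc, at distance [r cos h + 3/4 alpha sin h] from
    the center, and this is [r]: it is the identity that dictates the value of
    [alpha].  By symmetry the derivative there is parallel to the tangent, and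
    its coefficient is positive. *)
Lemma circle_avg (mu h : R) : 0 < h -> h < pi ->
  bezier_avg_defined (circle_node (mu - h)) (circle_node (mu + h)) /\
  bezier_avg (circle_node (mu - h)) (circle_node (mu + h)) = circle_node mu.
Proof.
move=> h0 hpi; set x := circle_node (mu - h); set y := circle_node (mu + h).
have sh : 0 < sin h by rewrite sin_gt0_pi // h0.
have rs : 0 < 2 * r * sin h by rewrite !mulr_gt0.
have dir : chord_dir x y = tangent mu.
  rewrite /chord_dir circle_chord normalizeZ // normalize_on_sphere //.
  exact: tangent_sphere.
have ang : angle_sum x y = 2 * h.
  rewrite /angle_sum dir /angle !dotp_tangent.
  have -> : mu - h - mu = - h by ring.
  have -> : mu + h - mu = h by ring.
  by rewrite cosN cosK ?in_itv /= ?ltW //; ring.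
split.
  split; last by rewrite ang ltr_pM2l.
  by apply: circle_step_neq; exists mu, h.
pose C := cos (h / 2); pose S := sin (h / 2).
have C0 : 0 < C.
  by rewrite /C cos_gt0_pihalf //; apply/andP; split; have := pi_gt0 R; lra.
have CS : S ^+ 2 = 1 - C ^+ 2 by rewrite -sin2cos2.
have hh : h = (h / 2) *+ 2 by rewrite mulr2n; field.
have ch : cos h = 2 * C ^+ 2 - 1 by rewrite {1}hh cos_mulr2n mulr_natl.
have shE : sin h = 2 * (C * S) by rewrite {1}hh sin_mulr2n mulr_natl.
have Cn0 : C != 0 by rewrite gt_eqF.
have al : bezier_alpha x y = 4 * r * S / (3 * C).
  rewrite /bezier_alpha circle_chord enormZ tangent_sphere mulr1 gtr0_norm // ang.
  have -> : 2 * h / 4 = h / 2 by field.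
  by rewrite -/C shE; field.
have mid : r * cos h + 3 / 4 * bezier_alpha x y * sin h = r.
  rewrite al ch shE.
  have -> : 3 / 4 * (4 * r * S / (3 * C)) * (2 * (C * S)) = 2 * r * S ^+ 2.
    by field.
  by rewrite CS; ring.
rewrite /bezier_avg /bezier_curve bezier3_half derive1_bezier3_half.
congr pair.
  rewrite /circle_pt -[in RHS]mid; move: (bezier_alpha x y) => al'.
  rewrite /x /y /= /circle_pt /circle_tangent cosB sinB cosD sinD.
  by apply/rowP => i; rewrite !mxE; field.
set w := (X in normalize X).
have -> : w =
    (3 / 4 * (4 * r * sin h - 2 * bezier_alpha x y * cos h)) *: tangent mu.
  rewrite /w; move: (bezier_alpha x y) => al'.
  rewrite /x /y /= /circle_pt /circle_tangent cosB sinB cosD sinD.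
  by apply/rowP => i; rewrite !mxE; field.
rewrite normalizeZ ?normalize_on_sphere //; first exact: tangent_sphere.
rewrite al shE ch.
have -> : 3 / 4 * (4 * r * (2 * (C * S))
    - 2 * (4 * r * S / (3 * C)) * (2 * C ^+ 2 - 1))
  = 2 * r * (C * S) * (1 + (C ^+ 2)^-1).
  by field.
have CS0 : 0 < C * S by move: sh; rewrite shE pmulr_rgt0.
apply: mulr_gt0; first by rewrite pmulr_rgt0 // mulr_gt0.
by rewrite addr_gt0 // invr_gt0 exprn_gt0.
Qed.

(** Distinct consecutive samples are joined by an arc of positive length less
    than a full turn, taken along the orientation. *)
Lemma circle_samples_chain Q :
  circle_samples c r e1 e2 Q <-> chain circle_step Q.
Proof.
split=> [[hQ hneq] i|h].
  have [phi [px vx]] := hQ i; have [psi [py vy]] := hQ (i + 1).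
  have [d [d0 d1 cd sd]] := unit_circle_angle _ _ (cos2Dsin2 (psi - phi)).
  have xE : Q i = circle_node phi by rewrite (surjective_pairing (Q i)) px vx.
  have yE : Q (i + 1) = circle_node (phi + d).
    rewrite (surjective_pairing (Q (i + 1))) py vy -/(circle_node psi).
    rewrite -[psi](subrK phi) (addrC (psi - phi)).
    move: (psi - phi) cd sd => w cw sw.
    by apply: circle_node_eq; rewrite ?cosD ?sinD cw sw.
  have dn0 : 0 < d.
    rewrite lt_neqAle d0 andbT eq_sym; apply/eqP => dE.
    by apply: (hneq i); rewrite xE yE dE addr0.
  exists (phi + d / 2), (d / 2); split; [lra|lra| |].
    by rewrite xE; congr circle_node; ring.
  by rewrite yE; congr circle_node; field.
split=> j; last exact: circle_step_neq.
by have [mu [h' [_ _ -> _]]] := h j; exists (mu - h').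
Qed.

(** Halving an arc gives two arcs of half length; averaging two adjacent arcs of
    half lengths [h] and [h'] gives an arc of half length [(h + h') / 2], which
    stays below [pi]. *)
Lemma circle_hblr (m : nat) P : circle_samples c r e1 e2 P ->
  hblr_defined m P /\ forall k, circle_samples c r e1 e2 (hblr_level m P k).
Proof.
move=> /circle_samples_chain CP.
have [] := hblr_chain circle_step m _ _ _ P CP.
- by move=> x y [mu [h [h0 h1 -> ->]]]; case: (circle_avg mu h h0 h1).
- move=> x y [mu [h [h0 h1 -> ->]]]; have [_ ->] := circle_avg mu h h0 h1.
  split; [exists (mu - h / 2), (h / 2)|exists (mu + h / 2), (h / 2)];
    by split; [lra|lra| |]; congr circle_node; field.
- move=> x y z [mu [h [h0 h1 -> ->]]] [mu' [h' [h'0 h'1 yE ->]]].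
  have [_ ->] := circle_avg mu h h0 h1.
  rewrite {1}yE; have [_ ->] := circle_avg mu' h' h'0 h'1.
  exists (mu + (h + h') / 2), ((h + h') / 2); split; [lra|lra| |].
    by congr circle_node; field.
  have -> : mu + (h + h') / 2 + (h + h') / 2 = mu + h + h' by field.
  by rewrite (circle_node_shift _ _ _ yE) subrK.
by move=> ? h; split=> // k; apply/circle_samples_chain.
Qed.

(** The component orthogonal to the plane and the distance to the center are
    1-Lipschitz and constant on the circle, so a point adherent to the circle is
    in its plane and at distance [r] from the center. *)
Lemma circle_pt_closed (p : 'rV[R]_n) :
  (forall e, 0 < e -> exists2 q, (exists phi, q = circle_pt c r e1 e2 phi)
     & enorm (q - p) < e) ->
  exists phi, p = circle_pt c r e1 e2 phi.
Proof.
move=> h.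
pose w (q : 'rV[R]_n) := q - dotp q e1 *: e1 - dotp q e2 *: e2.
have ww q : enorm (w q) <= enorm q.
  rewrite -(@ler_pXn2r _ 2) ?nnegrE ?enorm_ge0 // !sqr_enorm /w.
  rewrite !dotpE e11 e22 e12 e21 (dotpC e1 q) (dotpC e2 q).
  have := sqr_ge0 (dotp q e1); have := sqr_ge0 (dotp q e2); lra.
have wp : w (p - c) = 0.
  apply: enorm_small_eq0 => e /h[q [t ->] qp].
  apply: le_lt_trans qp.
  suff -> : w (p - c) = - w (circle_pt c r e1 e2 t - p) by rewrite enormN.
  rewrite /w /circle_pt !dotpE e11 e22 e12 e21.
  by apply/rowP => i; rewrite !mxE; ring.
have np : enorm (p - c) = r.
  have nq t : enorm (circle_pt c r e1 e2 t - c) = r.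
    have -> : circle_pt c r e1 e2 t - c = r *: (cos t *: e1 + sin t *: e2).
      by rewrite /circle_pt addrC addKr.
    rewrite enormZ gtr0_norm // (_ : enorm _ = 1) ?mulr1 //.
    apply: dotp_on_sphere; rewrite !dotpE e11 e22 e12 e21.
    by have := cos2Dsin2 t; lra.
  apply/eqP; rewrite eq_le; apply/andP; split;
    apply/ler_addgt0Pr => e /h[q [t ->]] qp.
    have -> : p - c = - (circle_pt c r e1 e2 t - p) + (circle_pt c r e1 e2 t - c).
      by apply/rowP => i; rewrite !mxE; ring.
    apply: le_trans (enorm_triangle _ _) _.
    by rewrite enormN nq addrC lerD2l ltW.
  rewrite -{1}(nq t).
  have -> : circle_pt c r e1 e2 t - c = (p - c) + (circle_pt c r e1 e2 t - p).
    by apply/rowP => i; rewrite !mxE; ring.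
  apply: le_trans (enorm_triangle _ _) _.
  by rewrite lerD2l ltW.
have pE : p - c = dotp (p - c) e1 *: e1 + dotp (p - c) e2 *: e2.
  by apply/eqP; rewrite -subr_eq0 opprD addrA; apply/eqP.
move: (dotp (p - c) e1) (dotp (p - c) e2) pE => a b pE.
have ab : a ^+ 2 + b ^+ 2 = r ^+ 2.
  by rewrite -np sqr_enorm pE !dotpE e11 e22 e12 e21; ring.
have [|d [_ _ cd sd]] := unit_circle_angle (a / r) (b / r).
  by rewrite !expr_div_n -mulrDl ab divff // expf_neq0 // gt_eqF.
exists d; rewrite /circle_pt cd sd scalerDr !scalerA.
by rewrite !(mulrC r) !divfK ?gt_eqF // -pE addrC subrK.
Qed.

End Circle.

(** * Similarities *)

Section Similarity.
Context {R : realType} {n : nat}.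
Context (a : R) (L : {linear 'rV[R]_n -> 'rV[R]_n}) (d : 'rV[R]_n).
Context (a0 : 0 < a) (LD : forall x y, dotp (L x) (L y) = dotp x y).
Implicit Types (x y : hermite R n) (P : int -> hermite R n) (v w : 'rV[R]_n).

Definition sim_pt v : 'rV[R]_n := a *: L v + d.
Definition sim x : hermite R n := (sim_pt x.1, L x.2).

Let linE := (linearD L, linearN L, linearZ_LR L).

Lemma enorm_lin v : enorm (L v) = enorm v.
Proof. by rewrite /enorm LD. Qed.

Lemma normalize_lin v : normalize (L v) = L (normalize v).
Proof. by rewrite /normalize enorm_lin linearZ. Qed.

Lemma lin_inj v w : L v = L w -> v = w.
Proof.
move=> e; apply/eqP; rewrite -subr_eq0; apply/eqP/enorm_eq0.
by rewrite -enorm_lin linearB e subrr /enorm -(scale0r v) dotpZl mul0r sqrtr0.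
Qed.

Lemma sim_ptB v w : sim_pt v - sim_pt w = a *: L (v - w).
Proof. by rewrite /sim_pt opprD addrACA subrr addr0 linearB scalerBr. Qed.

Lemma enorm_simB v w : enorm (sim_pt v - sim_pt w) = a * enorm (v - w).
Proof. by rewrite sim_ptB enormZ enorm_lin gtr0_norm. Qed.

Lemma sim_pt_inj v w : sim_pt v = sim_pt w -> v = w.
Proof.
move=> /eqP; rewrite -subr_eq0 sim_ptB scaler_eq0 gt_eqF //= linearB subr_eq0.
by move/eqP/lin_inj.
Qed.

Lemma angle_sum_sim x y : angle_sum (sim x) (sim y) = angle_sum x y.
Proof.
by rewrite /angle_sum /chord_dir sim_ptB normalizeZ // normalize_lin /angle !LD.
Qed.

Lemma bezier_avg_defined_sim x y :
  bezier_avg_defined x y -> bezier_avg_defined (sim x) (sim y).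
Proof.
by move=> [xy as2]; split; [move=> /sim_pt_inj|rewrite angle_sum_sim].
Qed.

(** Angles are preserved, hence [alpha] scales like the chord, and the control
    polygon is transported.  The Bezier point is an affine combination of the
    control points; the derivative is a linear one, so it is multiplied by [a],
    which normalization removes. *)
Lemma bezier_avg_sim x y : bezier_avg (sim x) (sim y) = sim (bezier_avg x y).
Proof.
have al : bezier_alpha (sim x) (sim y) = a * bezier_alpha x y.
  by rewrite /bezier_alpha enorm_simB angle_sum_sim mulrA.
rewrite /bezier_avg /bezier_curve !bezier3_half !derive1_bezier3_half al.
move: (bezier_alpha x y) => b; congr pair.
  rewrite /= /sim_pt !linE.
  by apply/rowP => i; rewrite !mxE; field.
rewrite [RHS]/= -normalize_lin -[RHS](normalizeZ _ _ a0) /= /sim_pt.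
congr normalize; rewrite !linE.
by apply/rowP => i; rewrite !mxE; field.
Qed.

Lemma smooth_iter_sim P l :
  iter l (@smooth R n) (refine0 (sim \o P)) =
  sim \o iter l (@smooth R n) (refine0 P).
Proof.
have refine_sim : refine0 (sim \o P) = sim \o refine0 P.
  apply/funext => j; rewrite /refine0 /comp; case: (_ == 0) => //.
  exact: bezier_avg_sim.
have smooth_sim U : smooth (sim \o U) = sim \o smooth U.
  by apply/funext => j; exact: (bezier_avg_sim (U j) (U (j + 1))).
elim: l => [|l IH]; first exact: refine_sim.
rewrite [LHS]iterS [in RHS]iterS -smooth_sim.
by congr (smooth _); exact: IH.
Qed.

Lemma hblr_level_sim m P k :
  hblr_level m (sim \o P) k = sim \o hblr_level m P k.
Proof. by elim: k => //= k ->; exact: smooth_iter_sim. Qed.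

Lemma hblr_defined_sim m P : hblr_defined m P -> hblr_defined m (sim \o P).
Proof.
move=> h k; have [h1 h2] := h k; rewrite hblr_level_sim.
split=> [i|l lm i]; first exact/bezier_avg_defined_sim/h1.
by rewrite smooth_iter_sim; exact/bezier_avg_defined_sim/h2.
Qed.

Lemma point_interpolant_sim m P k t :
  point_interpolant m (sim \o P) k t = sim_pt (point_interpolant m P k t).
Proof.
rewrite /point_interpolant /interpolant hblr_level_sim /linear_arc /= /sim_pt.
move: (2 ^+ k * t - _) => s; rewrite !linE.
by apply/rowP => i; rewrite !mxE; ring.
Qed.

Lemma tangent_interpolant_sim m P k t :
  tangent_interpolant m (sim \o P) k t = L (tangent_interpolant m P k t).
Proof.
rewrite /tangent_interpolant /interpolant hblr_level_sim /geodesic_arc /=.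
rewrite /angle !LD [RHS](linearD L).
congr (_ + _); rewrite [RHS](linearZ_LR L) //; congr (_ *: _).
by rewrite -normalize_lin !linE.
Qed.

Lemma hblr_converges_sim m P (gamma nu : R -> 'rV[R]_n) :
  hblr_converges m P gamma nu ->
  hblr_converges m (sim \o P) (sim_pt \o gamma) (L \o nu).
Proof.
move=> [hd hg [nu1 hanti hnu]]; split; first exact: hblr_defined_sim.
  move=> e e0; have := hg _ (divr_gt0 e0 a0); apply: filterS => k hk t.
  by rewrite point_interpolant_sim enorm_simB mulrC -ltr_pdivlMr.
split=> [t||e e0].
- by rewrite /on_sphere /= enorm_lin; exact: nu1.
- apply: filterS hanti => k hk j; rewrite hblr_level_sim /= -linearN.
  by move=> /lin_inj; exact: hk.
- have := hnu _ e0; apply: filterS => k hk t.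
  by rewrite tangent_interpolant_sim /angle /= LD; exact: hk.
Qed.

End Similarity.

(** The map [Phi - Phi 0] preserves norms and distances, hence, by
    polarization, inner products; then the squared norm of its defect of
    linearity expands to the value [0] that it has for the identity. *)
Lemma euclidean_isometry_linear {R : realType} {n : nat}
    (Phi : 'rV[R]_n -> 'rV[R]_n) : euclidean_isometry Phi ->
  exists L : {linear 'rV[R]_n -> 'rV[R]_n},
    (forall x y, dotp (L x) (L y) = dotp x y) /\
    forall x, Phi x - Phi 0 = L x.
Proof.
move=> iso.
have [f fE] : exists f, forall x, f x = Phi x - Phi 0.
  by exists (fun x => Phi x - Phi 0).
have sq x y : dotp (Phi x - Phi y) (Phi x - Phi y) = dotp (x - y) (x - y).
  by rewrite -!sqr_enorm iso.
have fn x : dotp (f x) (f x) = dotp x x by rewrite fE sq subr0.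
have fD x y : dotp (f x) (f y) = dotp x y.
  have h : dotp (f x - f y) (f x - f y) = dotp (x - y) (x - y).
    have -> : f x - f y = Phi x - Phi y by rewrite !fE opprB addrA subrK.
    exact: sq.
  move: h; rewrite !dotpE !fn (dotpC (f y)) (dotpC y); lra.
have flin : linear f.
  move=> b x y; apply/eqP; rewrite -subr_eq0; apply/eqP/dotp_eq0.
  rewrite opprD addrA !dotpE !fD !dotpE.
  rewrite (dotpC y x); ring.
pose L : {linear 'rV[R]_n -> 'rV[R]_n} :=
  HB.pack f (GRing.isLinear.Build R _ _ *:%R f flin).
by exists L; split=> // x; rewrite -fE.
Qed.

(** * The reconstruction and invariance theorem *)

Theorem theorem3p2 (R : realType) (n m : nat) (hn : (2 <= n)%N)
    (hm : (1 <= m)%N) :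
  [/\ forall (a u : 'rV[R]_n) (P : int -> hermite R n),
        on_sphere u -> line_samples a u P ->
        [/\ hblr_defined m P,
            forall k : nat, line_samples a u (hblr_level m P k)
          & forall gamma : R -> 'rV[R]_n, limit_point_curve m P gamma ->
              forall t : R, line_point a u (gamma t)],
      forall (c : 'rV[R]_n) (r : R) (e1 e2 : 'rV[R]_n)
             (P : int -> hermite R n),
        oriented_circle r e1 e2 -> circle_samples c r e1 e2 P ->
        [/\ hblr_defined m P,
            forall k : nat, circle_samples c r e1 e2 (hblr_level m P k)
          & forall gamma : R -> 'rV[R]_n, limit_point_curve m P gamma ->
              forall t : R, exists phi : R, gamma t = circle_pt c r e1 e2 phi]
    & forall (P : int -> hermite R n) (gamma nu : R -> 'rV[R]_n),
        hermite_data P -> hblr_converges m P gamma nu ->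
        (forall Phi : 'rV[R]_n -> 'rV[R]_n, euclidean_isometry Phi ->
           hblr_converges m (fun j => (Phi (P j).1, Phi (P j).2 - Phi 0))
             (fun t => Phi (gamma t)) (fun t => Phi (nu t) - Phi 0))
        /\
        (forall a : R, 0 < a ->
           hblr_converges m (fun j => (a *: (P j).1, (P j).2))
             (fun t => a *: gamma t) nu)].
Proof.
split.
- move=> a u P u1 /(line_hblr _ _ m _ u1)[hd hs]; split=> // gamma lim t.
  apply: line_point_closed => // e.
  move=> /(limit_point_curve_adherent _ _ _ lim t)[k [j kj]].
  by exists (hblr_level m P k j).1 => //; case: (hs k).
- move=> c r e1 e2 P oc /(circle_hblr _ _ _ _ oc m)[hd hs].
  split=> // gamma lim t; apply: circle_pt_closed => // e.
  move=> /(limit_point_curve_adherent _ _ _ lim t)[k [j kj]].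
  exists (hblr_level m P k j).1 => //.
  by case: (hs k) => /(_ j)[phi [-> _]] _; exists phi.
- move=> P gamma nu _ conv; split=> [Phi iso|a a0].
    have [L [LD LE]] := euclidean_isometry_linear Phi iso.
    have PhiE x : Phi x = sim_pt 1 L (Phi 0) x.
      by rewrite /sim_pt scale1r -LE subrK.
    have -> : (fun j => (Phi (P j).1, Phi (P j).2 - Phi 0)) = sim 1 L (Phi 0) \o P.
      by apply/funext => j; rewrite /sim /= -PhiE LE.
    have -> : (fun t => Phi (gamma t)) = sim_pt 1 L (Phi 0) \o gamma.
      by apply/funext => t /=; rewrite -PhiE.
    have -> : (fun t => Phi (nu t) - Phi 0) = L \o nu.
      by apply/funext => t /=; rewrite LE.
    exact: hblr_converges_sim.
  have simE x : sim_pt a idfun 0 x = a *: x by rewrite /sim_pt addr0.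
  have -> : (fun j => (a *: (P j).1, (P j).2)) = sim a idfun 0 \o P.
    by apply/funext => j; rewrite /sim /= simE.
  have -> : (fun t => a *: gamma t) = sim_pt a idfun 0 \o gamma.
    by apply/funext => t /=; rewrite simE.
  have -> : nu = @idfun 'rV[R]_n \o nu by [].
  exact: hblr_converges_sim.
Qed.
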